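(* Let $F$ be a separable Banach space and $\mathfrak D_{F'}\subset B_{F'}$ be countable and $w^*$-dense in $B_{F'}$, with enumeration $\mathfrak D_{F'}=\{y_i':i\ge1\}$. For $n\ge1$ define $A_n:F\to\mathbb R^n$ by $$A_n(y):=\bigl(y_1'(y),\dots,y_n'(y)\bigr),\qquad y\in F.$$ Then $(A_n)$ is a filtering sequence for $F$.
   Context: $F'$ is the dual of the real Banach space $F$ and $B_{F'}$ its closed unit ball. The $w^*$-topology on $F'$ is the smallest topology making all evaluations $y'\mapsto y'(y)$, $y\in F$, continuous. A sequence $(A_n)$ of bounded linear operators $A_n:F\to\mathbb R^n$ is called a filtering sequence for the separable Banach space $F$ if $\sigma(A_n)\subset\sigma(A_{n+1})$ for all $n\ge1$ and $\sigma(F')=\sigma(A_n:n\ge1)$, where $\sigma(F')$ is the smallest $\sigma$-algebra on $F$ making all $y'\in F'$ measurable, and $\sigma(A_n)$ is the $\sigma$-algebra generated by $A_n$ (with the Borel $\sigma$-algebra on $\mathbb R^n$). *)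

(* Defs.v *)
From HB Require Import structures.
From mathcomp Require Import all_boot all_order all_algebra.
From mathcomp Require Import all_classical all_reals all_analysis.

Set Implicit Arguments.
Unset Strict Implicit.
Unset Printing Implicit Defensive.

Import Order.TTheory GRing.Theory Num.Theory.
Import numFieldNormedType.Exports.

Local Open Scope classical_set_scope.
Local Open Scope ring_scope.

Definition separable (T : topologicalType) : Prop :=
  exists2 S : set T, countable S & dense S.

Section dual.
Context {R : realType} (F : normedModType R).

Record dual : Type := Dual {
  dual_linear :> {linear F -> R^o} ;
  dual_continuous : continuous dual_linear }.

HB.instance Definition _ := gen_eqMixin dual.
HB.instance Definition _ := gen_choiceMixin dual.

(* The operator norm; the set is nonempty and bounded, so [sup] is not used
   outside its domain. *)
Definition dual_norm (f : dual) : R :=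
  sup [set `|f y| | y in [set y : F | `|y| <= 1]].

Definition dual_unit_ball : set dual := [set f | dual_norm f <= 1].

Definition weak_star : Type :=
  sup_topology (fun y : F =>
    Topological.class (initial_topology (fun f : dual => (f y : R)))).

HB.instance Definition _ := Topological.on weak_star.

Definition weak_star_dense_in (D B : set dual) : Prop :=
  B `<=` (closure (D : set weak_star) : set weak_star).

End dual.

Arguments dual_unit_ball {R} F.

Definition borel_rV (R : realType) (n : nat) : Type :=
  g_sigma_algebraType (@open 'rV[R]_n).

HB.instance Definition _ (R : realType) (n : nat) := Measurable.on (borel_rV R n).

Section filtering.
Context {R : realType} (F : normedModType R).

Definition sigma_op (n : nat) (A : F -> 'rV[R]_n) : set (set F) :=
  g_sigma_algebra_preimage (A : F -> borel_rV R n).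

Definition sigma_dual : set (set F) :=
  <<s \bigcup_(f in [set: dual F])
        g_sigma_algebra_preimage ((f : F -> R) : F -> measurableTypeR R) >>.

(* [A 0], with values in R^0, is unconstrained: sequences start at 1. *)
Definition filtering_sequence (A : forall n : nat, F -> 'rV[R]_n) : Prop :=
  [/\ forall n, (1 <= n)%N -> linear (A n) /\ bounded_near (A n) (nbhs (0 : F)),
      forall n, (1 <= n)%N -> sigma_op (A n) `<=` sigma_op (A n.+1) &
      sigma_dual = <<s \bigcup_(n in [set n | (1 <= n)%N]) sigma_op (A n) >>].

End filtering.

(* Main.v *)
(* Every [f] in the dual is measurable for the sigma-algebra generated by the
   [y' i]: after rescaling, [f] lies in the unit ball, and since [F] is
   separable and the unit ball is equicontinuous, [f] is the pointwise limit of
   a sequence of the [y' i]. Conversely, the Borel sigma-algebra of R^n is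
   generated by the coordinates, so [A_n] is measurable as soon as the [y' i]
   with [i < n] are. *)
Require Import Defs.
From mathcomp Require Import all_boot all_order all_algebra.
From mathcomp Require Import all_classical all_reals all_analysis.
From mathcomp Require Import ring measurable_realfun.
Import Order.TTheory GRing.Theory Num.Theory.
Import numFieldNormedType.Exports.
Local Open Scope classical_set_scope.
Local Open Scope ring_scope.

(** Turns the inclusions between sigma-algebras in [filtering_sequence] into measurability of maps,
    where closure results are available. *)
Lemma measurable_fun_preimageP d d' (T : measurableType d)
    (U : measurableType d') (f : T -> U) :
  measurable_fun setT f <-> g_sigma_algebra_preimage f `<=` @measurable _ T.
Proof.
split=> [mf _ [B mB <-]|fT _ B mB]; first exact: mf.
by apply: fT; exists B.
Qed.

Lemma ball_rat_approx (R : realType) n (x : 'rV[R]_n) (e : R) : 0 < e ->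
  exists q : 'rV[rat]_n, ball (map_mx ratr q : 'rV[R]_n) e x.
Proof.
move=> e0.
have /choice[q qP] (i : 'I_n) : exists q : rat, ball (ratr q : R) e (x 0 i).
  have [|q] := @rat_in_itvoo R (x 0 i - e) (x 0 i + e).
    by rewrite ltrD2l (lt_trans _ e0)// oppr_lt0.
  rewrite in_itv/= => /andP[q1 q2]; exists q.
  by rewrite -ball_normE/= ltr_distl q1 q2.
exists (\row_i q i); split=> // i j.
by rewrite ord1 !mxE.
Qed.

(** Second countability, in a form suited to countable unions: the condition that the ball lies in
    [U] sits inside each piece, so the union runs over a whole countable type and unsuitable balls
    contribute the empty set. *)
Lemma open_rat_bigcup (R : realType) n (U : set 'rV[R]_n) : open U ->
  U = \bigcup_(qk in [set: 'rV[rat]_n * nat])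
        [set x | ball (map_mx ratr qk.1 : 'rV[R]_n) qk.2.+1%:R^-1 x /\
           ball (map_mx ratr qk.1 : 'rV[R]_n) qk.2.+1%:R^-1 `<=` U].
Proof.
move=> oU; apply/seteqP; split=> [x Ux|x [qk _ [qx qU]]]; last exact: qU.
have /nbhs_ballP[e /= e0 eU] : nbhs x U by exact: open_nbhs_nbhs.
(* Radius below [e / 2]: a ball of that radius that contains [x] then lies in the ball of radius [e]
   around [x]. *)
have [k _ /(_ _ (leqnn k)) /= ke] :=
  near_infty_natSinv_lt (PosNum (divr_gt0 e0 (ltr0n _ 2))).
have [|q qx] := @ball_rat_approx R n x k.+1%:R^-1; first by rewrite invr_gt0.
exists (q, k) => //; split=> //= z qz; apply: eU.
rewrite (splitr e); apply: (@ball_triangle _ _ (map_mx ratr q : 'rV[R]_n)).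
  by apply/ball_sym; apply: le_ball qx; exact: ltW.
by apply: le_ball qz; exact: ltW.
Qed.

(** Open sets are countable unions of rational balls, and a ball of row vectors is a box, so its
    preimage is a finite intersection of preimages of intervals under the coordinates. *)
Lemma measurable_fun_borel_rV (R : realType) d (T : measurableType d) n
    (f : T -> 'rV[R]_n) :
  (forall i, measurable_fun setT (fun t => f t 0 i)) ->
  measurable_fun setT (f : T -> borel_rV R n).
Proof.
move=> mf; apply: (@measurability _ _ T (borel_rV R n) _ _ (@open 'rV[R]_n)) => //.
move=> _ [U oU <-]; rewrite setTI (@open_rat_bigcup R n U oU) preimage_bigcup.
apply: countable_bigcupT_measurable => [|[q k]]; first exact: countableP.
have [qU|qU] := pselect (ball (map_mx ratr q : 'rV[R]_n) k.+1%:R^-1 `<=` U); last first.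
  by rewrite (_ : _ @^-1` _ = set0)//; apply/seteqP; split=> // t [].
rewrite (_ : _ @^-1` _ = \bigcap_(i in [set: 'I_n])
   (fun t => f t 0 i) @^-1` ball (ratr (q 0 i) : R) k.+1%:R^-1).
  apply: fin_bigcap_measurable => [|i _]; first exact: finite_finset.
  rewrite -[X in measurable X]setTI; apply: (mf i) => //.
  by apply: open_measurable; exact: ball_open.
apply/seteqP; split=> t /=.
  by move=> [[_ +] _] i _ => /(_ 0 i); rewrite mxE.
move=> ft; split=> //; split; first by rewrite invr_gt0.
by move=> i j; rewrite ord1 mxE; exact: ft.
Qed.

Lemma measurable_coord_borel_rV (R : realType) n (i : 'I_n) :
  measurable_fun setT ((fun x : 'rV[R]_n => x 0 i) : borel_rV R n -> R).
Proof.
apply: (measurability _ (RGenOpens.measurableE R)) => _ [_ [a [b ->]] <-].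
rewrite setTI; apply: sub_sigma_algebra.
by apply: open_comp => // x _; exact: coord_continuous.
Qed.

Section dual_unit_ball.
Context {R : realType} {F : normedModType R}.

Lemma dual_bounded (f : dual F) :
  exists2 M, 0 < M & forall y, `|f y| <= M * `|y|.
Proof.
have /linear_boundedP : bounded_near f (nbhs (0 : F)).
  exact/linear_bounded_continuous/dual_continuous.
by move=> /pinfty_ex_gt0[M M0 fM]; exists M.
Qed.

Lemma dual_unit_ballP (f : dual F) :
  dual_unit_ball F f <-> forall y, `|f y| <= `|y|.
Proof.
rewrite /dual_unit_ball /dual_norm /=; set S := [set _ | _ in _].
split=> [fle1 y|fle].
  have [->|y0] := eqVneq y 0; first by rewrite linear0 !normr0.
  have ny : 0 < `|y| by rewrite normr_gt0.
  suff : `|f (`|y|^-1 *: y)| <= 1.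
    by rewrite linearZ/= normrZ normfV normr_id ler_pdivrMl// mulr1.
  apply: le_trans fle1; apply: ub_le_sup.
    (* [sup] dominates the members of its set only if the set is bounded above; continuity of [f]
       supplies the bound. *)
    have [M M0 fM] := dual_bounded f; exists M => _ [z /= z1 <-].
    by rewrite (le_trans (fM z))// ger_pMr.
  by exists (`|y|^-1 *: y) => //=; rewrite normrZ normfV normr_id mulVf ?gt_eqF.
apply: ge_sup; first by exists `|f 0|, 0 => //=; rewrite normr0.
by move=> _ [z /= z1 <-]; rewrite (le_trans (fle z)).
Qed.

Lemma dual_scale (f : dual F) (c : R) :
  exists g : dual F, forall y, g y = c * f y.
Proof.
have cf : continuous (c \*: dual_linear f : F -> R^o).
  by move=> y; apply: cvgZl_tmp; exact: dual_continuous.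
by exists (@Dual R F (c \*: dual_linear f) cf).
Qed.

(** The supremum topology refines the initial topology of evaluation at [y], for which that
    evaluation is continuous. *)
Lemma weak_star_eval_continuous (y : F) :
  continuous (fun f : weak_star F => (f : dual F) y : R).
Proof.
move=> f; pose W := initial_topology (fun f : dual F => (f y : R)).
apply: (@cvg_trans _ ((fun f : W => (f : dual F) y : R) @ (f : W))).
  have [+ _] := @cvg_sup (dual F) F (fun y : F =>
    Topological.class (initial_topology (fun f : dual F => (f y : R))))
    (nbhs (f : weak_star F)) f _.
  by move=> /(_ (@cvg_id _ _) y) fW A; exact: fW.
exact: (@initial_continuous _ R (fun f : dual F => f y : R) f).
Qed.

(** A weak-star neighbourhood controls finitely many points only, so [h n] is chosen close to [f] at
    the first [n + 1] terms of a dense sequence; the common Lipschitz constant 1 carries the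
    convergence to every [y]. *)
Lemma weak_star_dense_cvg (D : set (dual F)) :
  separable F -> D `<=` dual_unit_ball F ->
  weak_star_dense_in D (dual_unit_ball F) ->
  forall f, dual_unit_ball F f ->
  exists2 h : nat -> dual F, (forall n, D (h n)) &
    forall y, (fun n => h n y : R) @ \oo --> (f y : R).
Proof.
move=> [S cS dS] DB dD f Bf.
(* A dense set meets the nonempty space [F], so it is nonempty and, being countable, is the range of
   a sequence. *)
have [s sS] : exists s : nat -> F, range s = S.
  have /pfcard_geP[S0|/unsquash s] := cS; last first.
    by exists s; exact: image_eq.
  have [//|x [_]] := dS setT _ openT; first by exists 0.
  by rewrite S0.
have /choice[h hP] (n : nat) : exists g, D g /\
    forall k, (k <= n)%N -> `|f (s k) - g (s k)| < n.+1%:R^-1.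
  have /(dD f Bf) : nbhs (f : weak_star F)
      [set g : dual F | forall k : 'I_n.+1, `|f (s k) - g (s k)| < n.+1%:R^-1].
    apply: (@filter_forall _ _ _ (nbhs (f : weak_star F))) => k.
    have /cvgrPdist_lt := @weak_star_eval_continuous (s k) f.
    by apply; rewrite invr_gt0.
  by case=> g [Dg fg]; exists g; split=> // k kn; exact: (fg (Ordinal (kn : (k < n.+1)%N))).
exists h => [n|y]; first exact: (hP n).1.
apply/cvgrPdist_lt => e e0.
have e3 : 0 < e / 3 by rewrite divr_gt0.
have [x [yx [k _ skx]]] : ball y (e / 3) `&` range s !=set0.
  rewrite sS; apply: dS; last exact: ball_open.
  by exists y; exact: ballxx.
have sE (g : dual F) : dual_unit_ball F g -> `|g y - g (s k)| < e / 3.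
  move=> /dual_unit_ballP g1; rewrite -linearB (le_lt_trans (g1 _))//.
  by rewrite skx; rewrite -ball_normE in yx.
near=> n.
(* The outer terms are small by the Lipschitz bound, the middle one by the choice of [h n] as soon
   as [k <= n] and [n.+1%:R^-1 < e / 3]. *)
have -> : f y - h n y = (f y - f (s k)) + (f (s k) - h n (s k)) + (h n (s k) - h n y).
  by rewrite !subrKA.
have -> : e = e / 3 + e / 3 + e / 3 by field.
rewrite (le_lt_trans (ler_normD _ _))// ltrD//; last first.
  by rewrite distrC sE//; exact/DB/(hP n).1.
rewrite (le_lt_trans (ler_normD _ _))// ltrD//; first exact: sE.
rewrite (lt_trans ((hP n).2 k _))//; near: n.
  exact: nbhs_infty_ge.
exact: (near_infty_natSinv_lt (PosNum e3)).
Unshelve. all: by end_near. Qed.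

(** The map [t] leaves the sigma-algebra free: with [t] the identity, [T] can be [F] with any chosen
    sigma-algebra. *)
Lemma measurable_dual d (T : measurableType d) (t : T -> F)
    (D : set (dual F)) :
  separable F -> D `<=` dual_unit_ball F ->
  weak_star_dense_in D (dual_unit_ball F) ->
  (forall g, D g -> measurable_fun setT (fun x => g (t x) : R)) ->
  forall f : dual F, measurable_fun setT (fun x => f (t x) : R).
Proof.
move=> sF DB dD mD f; have [M M0 fM] := dual_bounded f.
have [g gE] := dual_scale f M^-1.
have /(weak_star_dense_cvg D sF DB dD)[h hD hg] : dual_unit_ball F g.
  by apply/dual_unit_ballP => y; rewrite gE normrM gtr0_norm ?invr_gt0// ler_pdivrMl.
have mg : measurable_fun setT (fun x => g (t x) : R).
  by apply: (@measurable_fun_cvg _ T R _ (fun n x => h n (t x))) => // n; exact: mD.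
apply: (eq_measurable_fun (fun x => M * g (t x))) => [x _|].
  by rewrite gE mulVKf// gt_eqF.
exact: measurable_funM.
Qed.

End dual_unit_ball.

Lemma bounded_near_row (R : realType) (F : normedModType R) n
    (f : 'I_n -> dual F) :
  bounded_near (fun y : F => \row_i (f i y : R)) (nbhs (0 : F)).
Proof.
(* A map that converges at 0 is bounded near 0, and convergence of a row is convergence of its
   finitely many entries. *)
apply: (@cvg_bounded _ _ _ _ _ _ (\row_i (f i 0 : R))).
apply/cvg_ballP => e e0; near=> y; split=> // i j; rewrite !mxE.
move: j; near: y; apply: filter_forall => j.
by have /cvg_ballP := @dual_continuous _ _ (f j) 0; apply.
Unshelve. all: by end_near. Qed.

Theorem theorem4p2 (R : realType) (F : completeNormedModType R)
    (sepF : separable F)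
    (D : set (dual F)) (cD : countable D)
    (DB : D `<=` dual_unit_ball F)
    (dD : weak_star_dense_in D (dual_unit_ball F))
    (y' : nat -> dual F) (y'D : range y' = D) :
  filtering_sequence (fun (n : nat) (y : F) => \row_(i < n) (y' i y : R)).
Proof.
pose A n (y : F) := \row_(i < n) (y' i y : R).
split=> [n _|n _|].
- split; last exact: bounded_near_row.
  by move=> a x y; apply/rowP => i; rewrite !mxE linearP.
(* On [F] with the sigma-algebra of [A n.+1], each coordinate of [A n] is measurable, being a
   coordinate of [A n.+1]. *)
- pose T := g_sigma_algebra_preimageType (A n.+1 : F -> borel_rV R n.+1).
  apply/(@measurable_fun_preimageP _ _ T (borel_rV R n)).
  apply: measurable_fun_borel_rV => i.
  apply: (eq_measurable_fun (fun y : T => A n.+1 y 0 (widen_ord (leqnSn n) i))).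
    by move=> y _; rewrite !mxE.
  apply: (measurableT_comp (measurable_coord_borel_rV R _ _)).
  by apply/measurable_fun_preimageP.
- apply/seteqP; split; apply: smallest_sub; try exact: smallest_sigma_algebra.
  + pose T := g_sigma_algebraType (\bigcup_(n in [set n | (1 <= n)%N]) sigma_op (A n)).
    move=> B [f _]; apply/(@measurable_fun_preimageP _ _ T (measurableTypeR R)): B.
    apply: (@measurable_dual R F _ T id D) => //.
    rewrite -y'D => _ [i _ <-].
    (* The enumeration starts at 0, so [y' i] is the last coordinate of [A i.+1], whose index is at
       least 1 as the union requires. *)
    apply: (eq_measurable_fun (fun y : T => A i.+1 y 0 ord_max)).
      by move=> y _; rewrite !mxE.
    apply: (measurableT_comp (measurable_coord_borel_rV R _ _)).
    apply/measurable_fun_preimageP => B iB.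
    by apply: sub_sigma_algebra; exists i.+1.
  + pose T := g_sigma_algebraType (\bigcup_(f in [set: dual F])
      g_sigma_algebra_preimage ((f : F -> R) : F -> measurableTypeR R)).
    move=> B [n _]; apply/(@measurable_fun_preimageP _ _ T (borel_rV R n)): B.
    apply: measurable_fun_borel_rV => i.
    apply: (eq_measurable_fun (fun y : T => y' i y : R)).
      by move=> y _; rewrite !mxE.
    apply/measurable_fun_preimageP => B iB.
    by apply: sub_sigma_algebra; exists (y' i).
Qed.
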